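(* In the two-player Levine hat game with infinite stacks, there exists a recursive strategy $K$ of order $5$ such that, when both players use $K$ (a symmetrical pair of strategies), the probability of victory equals $\frac{7}{20}$.
   Context: Two-player Levine hat game with infinite stacks: players A and B have stacks $U=(U^{(k)})_{k\ge1}$ and $V=(V^{(k)})_{k\ge1}$, all entries being independent Bernoulli$(1/2)$ variables ($1$ = black, $0$ = white). Each player sees only the other player's stack and names an index in $\{1,2,3,\dots\}$. If A uses the (measurable) strategy $K_1$ and B uses $K_2$, the players win if and only if $U^{(K_1(V))}=1$ and $V^{(K_2(U))}=1$. An $h$-strategy is a function $k:\{0,1\}^h\to\{1,\dots,h\}$. A strategy $K$ is recursive of order $h$ if there are a non-empty set $\mathcal C\subsetneq\{0,1\}^h$ and an $h$-strategy $k_0$ such that $K$ is given by the following algorithm: cut the observed infinite stack into consecutive blocks of $h$ hats; skip each block not in $\mathcal C$; upon reaching the first block $u\in\mathcal C$, after $m\ge0$ skipped blocks, return $mh+k_0(u)$. (If no block lies in $\mathcal C$, an event of probability $0$, the returned value is arbitrary.) *)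

(* Defs.v *)
From HB Require Import structures.
From mathcomp Require Import all_boot all_order all_algebra finmap.
From mathcomp Require Import all_classical all_reals all_analysis.

Set Implicit Arguments.
Unset Strict Implicit.
Unset Printing Implicit Defensive.

Import Order.TTheory GRing.Theory Num.Theory.

Local Open Scope classical_set_scope.
Local Open Scope ring_scope.

(* An infinite stack of hats; [true] is black (1), [false] is white (0).
   Positions are numbered from 0: [v k] is the hat of 1-based index k + 1.
   All named indices below are shifted by one accordingly. *)
Definition stack : Type := nat -> bool.

Definition cylinders : set (set stack) :=
  [set A | exists (k : nat) (b : bool), A = [set v | v k = b]].

(* {0,1}^N with its product sigma-algebra; the carrier is still [stack]. *)
Definition stack_space := g_sigma_algebraType cylinders.

(* Measurable maps from the observed stack to the named position. *)
Definition strategy := {mfun stack_space >-> nat}.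

Definition block (h : nat) (v : stack) (m : nat) : h.-tuple bool :=
  [tuple v (m * h + i)%N | i < h].

Definition h_strategy (h : nat) := h.-tuple bool -> 'I_h.

(* Nothing is required of [K v] when no block of [v] lies in [C].  Since
   positions and the values of [k0] both start at 0, the 1-based value
   m h + k0(u) is again [m * h + k0 u]. *)
Definition recursive_with (h : nat) (C : {set h.-tuple bool})
    (k0 : h_strategy h) (K : stack -> nat) : Prop :=
  forall (v : stack) (m : nat),
    (forall j, (j < m)%N -> block h v j \notin C) ->
    block h v m \in C ->
    K v = (m * h + k0 (block h v m))%N.

Definition recursive (h : nat) (K : stack -> nat) : Prop :=
  exists (C : {set h.-tuple bool}) (k0 : h_strategy h),
    [/\ C != finset.set0, C \proper [set: h.-tuple bool]%SET &
        recursive_with C k0 K].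

Definition mutually_independent d d' (T : measurableType d)
    (T' : measurableType d') (R : realType) (P : probability T R)
    (I : choiceType) (X : I -> {RV P >-> T'}) : Prop :=
  forall (J : {fset I}) (E : I -> set T'),
    (forall j, measurable (E j)) ->
    P (\bigcap_(j in [set` J]) (X j @^-1` E j)) =
    (\prod_(j <- J) P (X j @^-1` E j))%E.

Definition all_hats d (T : measurableType d) (R : realType)
    (P : probability T R) (U V : nat -> {RV P >-> bool}) (c : nat + nat) :
    {RV P >-> bool} :=
  match c with inl k => U k | inr k => V k end.

Definition fair_independent_stacks d (T : measurableType d) (R : realType)
    (P : probability T R) (U V : nat -> {RV P >-> bool}) : Prop :=
  (forall c, distribution P (all_hats U V c) = bernoulli_prob (1 / 2)) /\
  mutually_independent (all_hats U V).

(* Player A owns [U], observes [V] and uses [K1]; player B owns [V],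
   observes [U] and uses [K2]. *)
Definition victory d (T : measurableType d) (R : realType)
    (P : probability T R) (U V : nat -> {RV P >-> bool})
    (K1 K2 : stack -> nat) : set T :=
  [set w | U (K1 (fun k => V k w)) w = true /\
           V (K2 (fun k => U k w)) w = true].

(* Main.v *)
From HB Require Import structures.
Require Import Defs.
From mathcomp Require Import all_boot all_order all_algebra finmap.
From mathcomp Require Import all_classical all_reals all_analysis.
From mathcomp Require Import ring lra.

Set Implicit Arguments.
Unset Strict Implicit.
Unset Printing Implicit Defensive.

Import Order.TTheory GRing.Theory Num.Theory.
Import numFieldNormedType.Exports.

Local Open Scope classical_set_scope.
Local Open Scope ring_scope.

(** A recursive strategy sees its stacks only through blocks of [h] hats, so
    the game is a race between two players reading i.i.d. pairs of blocks
    [(u, v)].  Write [N] for the number of blocks, [m] for the number of those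
    that are skipped (outside [C]), and [rho = m / N].  Look at the first pair
    with a block in [C].

    - If both blocks are in [C], both players stop there and the outcome is
      read off [(u, v)].
    - If only [u] is in [C], the player who sees [u] stops and names a hat of
      [v].  The other one goes on and finally names a hat of their own in a
      block that the first one never reached; this hat is fair and independent
      of everything else.  The case contributes half the number of pairs
      [u \in C], [v \notin C] in which [v] is black at [k0 u], and so does its
      mirror image.

    Otherwise the race starts afresh.  The two halves in the second case add up,
    so if [score C k0] is the number of pairs with [u \in C] in which [v] is
    black at [k0 u] and, should [v] be in [C], [u] is black at [k0 v], then the
    probability of victory satisfies [p = score / N^2 + rho^2 p], and equals
    [score / (N^2 - m^2)] ([recursive_victory]).

    The self-similarity behind this equation is not applied to infinite stacks.
    Instead one counts: an event on the first [n] pairs of blocks has as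
    probability the fraction of words of length [n] that satisfy it
    ([prob_word]), and such fractions obey a recursion on [n] obtained by
    peeling off the first pair ([freqS]).  The fraction of winning words, where
    both players must stop within the word, satisfies the equation above up to
    a multiple of [rho^n] ([freq_winS]), and differs from the probability of
    victory by at most [2 rho^n] ([victory_bounds]).  As [rho < 1], the equation
    for [p] follows in the limit.

    For [h = 5] take for [C] all blocks but the two monochromatic ones, so that
    [N^2 - m^2 = 1024 - 4 = 1020].  The function [named_position] has score 357,
    and [357 / 1020 = 7 / 20]. *)

(** * Fractions of words satisfying a property *)

Lemma sum_tuple_cons (V : nmodType) (A : finType) (n : nat)
    (F : n.+1.-tuple A -> V) :
  \sum_t F t = \sum_a \sum_(t : n.-tuple A) F [tuple of a :: t].
Proof.
rewrite pair_big /=.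
rewrite (reindex (fun p : A * n.-tuple A => [tuple of p.1 :: p.2])) //.
exists (fun t => (thead t, [tuple of behead t])) => [[a t] _ | t _] /=.
  by congr pair; apply/val_inj.
by rewrite -tuple_eta.
Qed.

(** Flipping the hat at position [i] exchanges black and white there. *)
Lemma card_tuple_tnth (h : nat) (i : 'I_h) :
  (\sum_(t : h.-tuple bool) (tnth t i : nat)).*2 = #|{: h.-tuple bool}|.
Proof.
pose flip (t : h.-tuple bool) :=
  [tuple if j == i then ~~ tnth t j else tnth t j | j < h].
have flipK : involutive flip.
  move=> t; apply: eq_from_tnth => j; rewrite !tnth_mktuple.
  by case: eqP => // _; rewrite negbK.
rewrite -addnn {2}(reindex_inj (inv_inj flipK)) -big_split -sum1_card /=.
by apply: eq_bigr => t _; rewrite tnth_mktuple eqxx; case: (tnth t i).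
Qed.

Section Frequency.
Variables (R : realFieldType) (A : finType).
Hypothesis A_gt0 : (0 < #|A|)%N.

Definition freq (n : nat) (F : seq A -> bool) : R :=
  (\sum_(t : n.-tuple A) (F t)%:R) / #|A|%:R ^+ n.

Lemma eq_freq n (F G : seq A -> bool) : F =1 G -> freq n F = freq n G.
Proof. by move=> FG; rewrite /freq; under eq_bigr do rewrite FG. Qed.

Lemma freqS n F :
  freq n.+1 F = (\sum_a freq n (fun s => F (a :: s))) / #|A|%:R.
Proof.
by rewrite /freq sum_tuple_cons -mulr_suml exprS invfM mulrAC mulrA.
Qed.

Lemma freq_cst n b : freq n (fun=> b) = b%:R.
Proof.
rewrite /freq sumr_const card_tuple -[X in X / _]mulr_natr natrX mulfK//.
by rewrite expf_neq0// pnatr_eq0 -lt0n.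
Qed.

Lemma freq0 F : freq 0 F = (F [::])%:R.
Proof.
rewrite /freq (big_pred1 [tuple]) ?expr0 ?divr1// => t.
exact/esym/eqP/tuple0.
Qed.

End Frequency.

Lemma freqS_pair (R : realFieldType) (A B : finType) n
    (F : seq (A * B) -> bool) :
  freq R n.+1 F =
  (\sum_a \sum_b freq R n (fun s => F ((a, b) :: s))) / (#|A|%:R * #|B|%:R).
Proof.
rewrite freqS card_prod natrM pair_bigA; congr (_ / _).
by apply: eq_bigr => -[].
Qed.

Lemma freq_map (R : realFieldType) (A : finType) (f : A -> A) n F :
  involutive f -> freq R n (F \o map f) = freq R n F.
Proof.
move=> fK; have mapK : involutive (fun t : n.-tuple A => [tuple of map f t]).
  by move=> t; apply: val_inj; rewrite /= mapK.
by rewrite /freq [in RHS](reindex_inj (inv_inj mapK)).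
Qed.

(** * The race on finite words *)

Section Race.
Variables (h : nat) (C : {set h.-tuple bool}) (k0 : h_strategy h).

Local Notation letter := (h.-tuple bool * h.-tuple bool)%type.

(** A player whose own blocks are the first components reads the second ones,
    stops at the first of these in [C], and tests the hat named in the matching
    own block.  The default [false] makes [hit] entail that the player stops
    within the word. *)
Fixpoint hit (s : seq letter) : bool :=
  if s is (own, seen) :: s' then
    if seen \in C then tnth own (k0 seen) else hit s'
  else false.

Definition stops (s : seq letter) : bool := has (fun a => a.2 \in C) s.

Definition win (s : seq letter) : bool := hit s && hit (map swap_pair s).

(** The weight of a first letter [(u, v)] that is not skipped by both: the
    letters where a single player stops are listed with [u \in C] only, which
    makes up for the probability 1/2 of success of the other player. *)
Definition score : nat :=
  \sum_(u in C) \sum_v (tnth v (k0 u) && ((v \in C) ==> tnth u (k0 v))).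

Variable R : realFieldType.

Local Notation N := (#|{: h.-tuple bool}|%:R : R).
Local Notation m := (#|~: C|%:R : R).
Local Notation rho := (m / N).

Lemma card_block_gt0 : 0 < N.
Proof. by rewrite ltr0n card_tuple card_bool expn_gt0. Qed.

Lemma rho_lt1 : C != finset.set0 -> 0 <= rho < 1.
Proof.
move=> C_neq0; rewrite divr_ge0 ?ler0n //= ltr_pdivrMr ?card_block_gt0 // mul1r.
by rewrite ltr_nat -[ltnRHS](cardsC C) -[ltnLHS]add0n ltn_add2r card_gt0.
Qed.

Lemma hit_stops w : hit w -> stops w.
Proof. by elim: w => //= -[own seen] w IH; rewrite /stops /=; case: ifP. Qed.

Lemma card_letter_gt0 : (0 < #|{: letter}|)%N.
Proof. by rewrite card_prod muln_gt0 !card_tuple card_bool expn_gt0. Qed.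

Lemma sum_notin : \sum_v (v \notin C)%:R = m.
Proof.
rewrite -sum1_card natr_sum [in RHS]big_mkcond /=.
by apply: eq_bigr => v _; rewrite inE; case: (v \in C).
Qed.

Lemma sum_in : \sum_v (v \in C)%:R = N - m.
Proof.
apply/eqP; rewrite eq_sym subr_eq -sum_notin -big_split /=; apply/eqP.
rewrite -sum1_card natr_sum; apply: eq_bigr => v _.
by case: (v \in C); rewrite ?addr0 ?add0r.
Qed.

Lemma sum_tnth (i : 'I_h) : \sum_(u : h.-tuple bool) (tnth u i)%:R = N / 2 :> R.
Proof.
by rewrite -(card_tuple_tnth i) -natr_sum -muln2 natrM mulfK.
Qed.

Lemma freq_stops n : freq R n (fun w => ~~ stops w) = rho ^+ n.
Proof.
have N0 := lt0r_neq0 card_block_gt0.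
elim: n => [|n IH]; first by rewrite freq0 expr0.
rewrite freqS_pair.
under eq_bigr => u _.
  under eq_bigr => v _.
    have -> : freq R n (fun w => ~~ stops ((u, v) :: w)) =
        (v \notin C)%:R * rho ^+ n.
      rewrite /stops /=; case: (v \in C) => /=; last by rewrite mul1r -IH.
      by rewrite mul0r (freq_cst _ card_letter_gt0).
  over.
  rewrite -mulr_suml sum_notin.
over.
rewrite sumr_const -mulr_natr exprS; field.
exact: N0.
Qed.

(** The named hat belongs to a block that played no part in stopping, so it is
    black in half of the words in which the player stops. *)
Lemma freq_hit n : freq R n hit = (1 - rho ^+ n) / 2.
Proof.
have N0 := lt0r_neq0 card_block_gt0.
elim: n => [|n IH]; first by rewrite freq0 expr0 subrr mul0r.
rewrite freqS_pair.
rewrite exchange_big /=.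
have E v : \sum_u freq R n (fun w => hit ((u, v) :: w)) =
    (v \in C)%:R * (N / 2) + (v \notin C)%:R * (N * ((1 - rho ^+ n) / 2)).
  rewrite /=; case: (v \in C) => /=.
    rewrite mul1r mul0r addr0 -(sum_tnth (k0 v)); apply: eq_bigr => u _.
    exact: (freq_cst _ card_letter_gt0).
  by rewrite mul1r mul0r add0r -IH sumr_const mulr_natl.
under eq_bigr do rewrite E.
rewrite big_split /= -!mulr_suml sum_in sum_notin exprS; field.
exact: N0.
Qed.

Let both u v : R := (tnth u (k0 v) && tnth v (k0 u))%:R.
Let X : R := \sum_u \sum_v (u \in C)%:R * (v \notin C)%:R * (tnth v (k0 u))%:R.
Let W : R := \sum_u \sum_v (u \in C)%:R * (v \in C)%:R * both u v.

Lemma scoreE : score%:R = W + X.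
Proof.
rewrite /score natr_sum big_mkcond /= /W /X -big_split /=.
apply: eq_bigr => u _.
rewrite -big_split /=; case: (u \in C) => /=; last first.
  by rewrite big1 // => v _; rewrite !mul0r addr0.
rewrite natr_sum; apply: eq_bigr => v _; rewrite /both.
rewrite mul1r; case: (v \in C) => /=; first by rewrite !mul1r mul0r addr0 andbC.
by rewrite andbT mul0r add0r !mul1r.
Qed.

(** Peeling off the first letter gives four cases.  When exactly one player
    stops there, the other still has to succeed in the remaining word, which
    happens with frequency [(1 - rho ^+ n) / 2]; hence the correction term. *)
Lemma freq_winS : exists X : R, forall n,
  freq R n.+1 win =
  (score%:R - X * rho ^+ n) / N ^+ 2 + rho ^+ 2 * freq R n win.
Proof.
exists X => n.
have N0 := lt0r_neq0 card_block_gt0.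
set r := freq R n hit; set q := freq R n win.
have rB : freq R n (hit \o map swap_pair) = r by apply: freq_map; case.
rewrite freqS_pair.
have E u v : freq R n (fun w => win ((u, v) :: w)) =
   (u \in C)%:R * (v \in C)%:R * both u v
   + (u \in C)%:R * (v \notin C)%:R * (tnth v (k0 u))%:R * r
   + (v \in C)%:R * (u \notin C)%:R * (tnth u (k0 v))%:R * r
   + (u \notin C)%:R * (v \notin C)%:R * q.
  rewrite /win /= /both.
  case: (u \in C); case: (v \in C);
    rewrite /= ?(mulr0, mul0r, addr0, add0r, mul1r) //.
  - exact: (freq_cst _ card_letter_gt0).
  - case: (tnth v (k0 u)); rewrite ?mul1r ?mul0r.
      by apply: eq_freq => w; rewrite andbT.
    rewrite -[RHS]/((false : nat)%:R) -(freq_cst R card_letter_gt0 n false).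
    by apply: eq_freq => w; rewrite andbF.
  - case: (tnth u (k0 v)); rewrite ?mul1r ?mul0r; first exact: rB.
    exact: (freq_cst _ card_letter_gt0).
under eq_bigr => u _.
  under eq_bigr do rewrite E.
  rewrite !big_split /=.
over.
rewrite !big_split /= -/W.
have -> : \sum_u \sum_v
    (u \in C)%:R * (v \notin C)%:R * (tnth v (k0 u))%:R * r = X * r.
  by rewrite /X mulr_suml; apply: eq_bigr => u _; rewrite mulr_suml.
have -> : \sum_u \sum_v
    (v \in C)%:R * (u \notin C)%:R * (tnth u (k0 v))%:R * r = X * r.
  rewrite exchange_big /X mulr_suml; apply: eq_bigr => u _; rewrite mulr_suml.
  by apply: eq_bigr.
have -> : \sum_u \sum_v (u \notin C)%:R * (v \notin C)%:R * q = m ^+ 2 * q.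
  under eq_bigr do rewrite -mulr_suml -mulr_sumr sum_notin.
  by rewrite -!mulr_suml sum_notin expr2.
rewrite scoreE /r freq_hit; field.
exact: N0.
Qed.

End Race.

(** * From stacks to words *)

Definition play (h : nat) (u v : stack) (i n : nat) :=
  [seq (block h u k, block h v k) | k <- iota i n].

Lemma hit_play (h : nat) (C : {set h.-tuple bool}) k0 K (u v : stack) n :
  recursive_with C k0 K -> stops C (play h u v 0 n) ->
  hit C k0 (play h u v 0 n) = u (K v).
Proof.
move=> recK.
(* generalize to words starting at a block before which all are skipped *)
have : forall j, (j < 0)%N -> block h v j \notin C by [].
elim: n 0%N => [//|n IH] i notC /=.
case: ifPn => [iC _ | niC /=].
  by rewrite tnth_mktuple (recK v i).
by apply: IH => j; rewrite ltnS leq_eqVlt => /predU1P[-> // | /notC].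
Qed.

Section FairStacks.
Variables (R : realType) (d : measure_display) (T : measurableType d).
Variables (P : probability T R) (U V : nat -> {RV P >-> bool}) (h : nat).

Local Notation letter := (h.-tuple bool * h.-tuple bool)%type.

Definition word (n : nat) (w : T) := play h (U ^~ w) (V ^~ w) 0 n.

(** A hat of the first [n] letters is addressed by its owner ([true] for the
    owner of [U]), its block and its position in the block. *)
Let position n (x : bool * 'I_n * 'I_h) : nat + nat :=
  let: (side, m, i) := x in
  if side then inl (m * h + i)%N else inr (m * h + i)%N.

Let position_inj n : injective (@position n).
Proof.
move=> [[b m] i] [[b' m'] i'] /= E.
have Emi : (m * h + i = m' * h + i')%N.
  by case: b b' E => -[] // [].
have h_gt0 := leq_ltn_trans (leq0n i) (ltn_ord i).
have Em : m = m'.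
  apply: val_inj => /=; have := congr1 (divn^~ h) Emi.
  by rewrite !divnMDl // !divn_small // !addn0.
have Ei : i = i'.
  by apply: val_inj => /=; move: Emi; rewrite Em => /addnI.
by rewrite Em Ei; case: b b' E => -[].
Qed.

Let hats n : {fset nat + nat} := seq_fset tt (map (@position n) (enum predT)).

Let hat_value n (t : n.-tuple letter)
    (x : bool * 'I_n * 'I_h) : bool :=
  let: (side, m, i) := x in
  tnth (if side then (tnth t m).1 else (tnth t m).2) i.

(** [position] being injective, this is a singleton at each of the first
    [n * h] hats of either stack, and no constraint elsewhere. *)
Let prescribed n (t : n.-tuple letter) c : set bool :=
  [set b | forall x, position x = c -> b = hat_value t x].

Let word_atomE n (t : n.-tuple letter) :
  [set w | word n w = t] =
  \bigcap_(c in [set` hats n]) (all_hats U V c @^-1` prescribed t c).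
Proof.
apply/seteqP; split => w /=.
  move=> wt c _ [[b m] i] /= <-.
  have Em : tnth t m = (block h (U ^~ w) m, block h (V ^~ w) m).
    rewrite (tnth_nth (tnth t m)) -wt (nth_map 0%N) ?size_iota//.
    by rewrite nth_iota// add0n.
  by rewrite Em; case: b; rewrite /= tnth_mktuple.
move=> wt.
have hat x : all_hats U V (position x) w = hat_value t x.
  by apply: (wt (position x)) => //=; rewrite seq_fsetE map_f// mem_enum.
apply: (@eq_from_nth _ ([tuple of nseq h true], [tuple of nseq h true])).
  by rewrite size_map size_iota size_tuple.
move=> i; rewrite size_map size_iota => im.
rewrite (nth_map 0%N) ?size_iota// nth_iota// add0n.
set def := ([tuple of nseq h true], _).
have /= <- := tnth_nth def t (Ordinal im); rewrite [RHS]surjective_pairing.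
congr pair; apply: eq_from_tnth => j; rewrite tnth_mktuple.
  exact: (hat (true, Ordinal im, j)).
exact: (hat (false, Ordinal im, j)).
Qed.

Lemma measurable_word_atom n (t : n.-tuple letter) :
  measurable [set w | word n w = t].
Proof.
rewrite word_atomE; apply: fin_bigcap_measurable => [|c _].
  exact: finite_fset.
exact: measurable_funPTI.
Qed.

Hypothesis fairUV : fair_independent_stacks U V.

Let fair_hat c b : P (all_hats U V c @^-1` [set b]) = (2^-1)%:E.
Proof.
rewrite -[LHS]/(distribution P (all_hats U V c) [set b]) fairUV.1.
rewrite bernoulli_probE; last by lra.
rewrite !diracE !classical_sets.in_set1 -!EFinM -EFinD /unstable.onem.
congr EFin.
by case: b => /=; lra.
Qed.

Lemma prob_word_atom n (t : n.-tuple letter) :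
  P [set w | word n w = t] =
  ((#|{: letter}|%:R ^+ n)^-1)%:E.
Proof.
rewrite word_atomE fairUV.2 //.
have -> : (\prod_(c <- hats n) P (all_hats U V c @^-1` prescribed t c) =
    \prod_(c <- hats n) (2^-1)%:E)%E.
  rewrite !big_seq; apply: eq_bigr => c.
  rewrite seq_fsetE => /mapP[x _ ->].
  rewrite -(fair_hat (position x) (hat_value t x)); congr (P (_ @^-1` _)).
  apply/seteqP; split => b /=; first exact.
  by move=> -> y /position_inj ->.
rewrite prodEFin big_const_seq count_predT size_seq_fset undup_id; last first.
  by rewrite (map_inj_uniq (@position_inj n)) enum_uniq.
rewrite size_map -cardE !card_prod !card_ord !card_tuple card_bool iter_mulr_1.
rewrite exprVn -!natrX -expnD -expnM; congr (_ ^ _)%:R^-1%:E; ring.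
Qed.

(** An event on finite words is a finite disjoint union of words, all of the
    same probability. *)
Lemma prob_word n (F : seq letter -> bool) :
  measurable [set w | F (word n w)] /\
  P [set w | F (word n w)] = (freq R n F)%:E.
Proof.
pose r := [seq t : n.-tuple _ <- enum predT | F t].
have -> : [set w | F (word n w)] =
    \bigcup_(t in [set` r]) [set w | word n w = t].
  apply/seteqP; split => w /=.
    have sz : size (word n w) == n by rewrite size_map size_iota.
    by move=> Fw; exists (Tuple sz) => //=; rewrite mem_filter mem_enum Fw.
  by move=> [t /=]; rewrite mem_filter => /andP[Ft _] ->.
split.
  by apply: fin_bigcup_measurable => // t _; exact: measurable_word_atom.
rewrite measure_fin_bigcup //=; last 2 first.
- by move=> t t' _ _ [w [/= -> /val_inj]].
- by move=> t _; exact: measurable_word_atom.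
rewrite -fsbig_seq; last exact/filter_uniq/enum_uniq.
rewrite (eq_bigr _ (fun t _ => prob_word_atom t)) /=.
rewrite sumEFin big_filter big_enum_cond; congr EFin.
rewrite /freq mulr_suml big_mkcond; apply: eq_bigr => t _.
by case: (F t); rewrite ?mul1r ?mul0r.
Qed.

Variables (C : {set h.-tuple bool}) (k0 : h_strategy h) (K : strategy).
Hypothesis C_neq0 : C != finset.set0.
Hypothesis recK : recursive_with C k0 K.

Let measurable_own_hat (X Y : nat -> {RV P >-> bool}) :
  measurable [set w | X (K (Y ^~ w)) w].
Proof.
have mY : measurable_fun [set: T] (fun w => (Y ^~ w) : stack_space).
  apply: (@measurability _ _ T stack_space setT _ cylinders) => //.
  move=> _ [_ [k [b ->]] <-].
  rewrite setTI -[X in measurable X]/(Y k @^-1` [set b]).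
  exact: measurable_funPTI.
have mKY : measurable_fun [set: T] (fun w => K (Y ^~ w)).
  exact: (measurableT_comp (measurable_funPT K) mY).
have -> : [set w | X (K (Y ^~ w)) w] =
    \bigcup_k ([set w | K (Y ^~ w) = k] `&` X k @^-1` [set true]).
  apply/seteqP; split => w /=; last by move=> [k _ [/= <-]].
  by move=> Xw; exists (K (Y ^~ w)).
apply: bigcupT_measurable => k.
apply: measurableI; last exact: measurable_funPTI.
by rewrite -[X in measurable X]setTI; exact: (mKY measurableT [set k]).
Qed.

Lemma measurable_victory : measurable (victory U V K K).
Proof. by apply: measurableI; exact: measurable_own_hat. Qed.

Let map_swap_play u v i n :
  map swap_pair (play h u v i n) = play h v u i n.
Proof. by rewrite /play -map_comp. Qed.

Local Notation N := (#|{: h.-tuple bool}|%:R : R).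
Local Notation m := (#|~: C|%:R : R).

(** A winning word forces victory, and victory is visible on the word unless
    one of the players does not stop within it. *)
Lemma victory_bounds n :
  ((freq R n (win C k0))%:E <= P (victory U V K K) <=
   (freq R n (win C k0) + 2 * (m / N) ^+ n)%:E)%E.
Proof.
have [mwin Pwin] := prob_word n (win C k0).
have [mA PA] := prob_word n (fun w => ~~ stops C w).
have [mB PB] := prob_word n (fun w => ~~ stops C (map swap_pair w)).
have EB : freq R n (fun w => ~~ stops C (map swap_pair w)) = (m / N) ^+ n.
  by rewrite -freq_stops -[RHS](@freq_map _ _ swap_pair) //; case.
have winP w : stops C (word n w) -> stops C (map swap_pair (word n w)) ->
    win C k0 (word n w) <-> victory U V K K w.
  rewrite /win /word map_swap_play => sA sB.
  rewrite (hit_play recK sA) (hit_play recK sB).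
  by split => [/andP[]|[-> ->]].
apply/andP; split.
  rewrite -Pwin; apply: le_measure; rewrite ?inE //.
    exact: measurable_victory.
  by move=> w /= /[dup] /andP[/hit_stops ? /hit_stops ?] /winP; apply.
rewrite mulr_natl mulr2n addrA -{2}EB -(freq_stops C) !EFinD -Pwin -PA -PB.
apply: (@le_trans _ _ (P ([set w | win C k0 (word n w)] `|`
    [set w | ~~ stops C (word n w)] `|`
    [set w | ~~ stops C (map swap_pair (word n w))]))).
  apply: le_measure; rewrite ?inE //; first exact: measurable_victory.
    by apply: measurableU => //; exact: measurableU.
  move=> w vic /=.
  case: (boolP (stops C (word n w))) => sA; last by left; right.
  case: (boolP (stops C (map swap_pair (word n w)))) => sB; last by right.
  by left; left; apply/winP.
apply: le_trans (measureU2 _ _ _) _ => //; first exact: measurableU.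
by apply: leeD2r; exact: measureU2.
Qed.

Theorem recursive_victory :
  P (victory U V K K) = ((score C k0)%:R / (N ^+ 2 - m ^+ 2))%:E.
Proof.
have N_gt0 : 0 < N := card_block_gt0 h R.
have /andP[rho_ge0 rho_lt1] := rho_lt1 R C_neq0.
set rho := m / N in rho_ge0 rho_lt1.
have [p pE] : exists p, P (victory U V K K) = p%:E.
  exists (fine (P (victory U V K K))); rewrite fineK // fin_num_measure //.
  exact: measurable_victory.
rewrite pE; congr EFin; set q := fun n => freq R n (win C k0).
have bounds n : p - 2 * rho ^+ n <= q n <= p.
  have := victory_bounds n; rewrite pE !lee_fin -/(q n) -/rho => /andP[? ?].
  by apply/andP; split; lra.
have rho_cvg0 : rho ^+ n @[n --> \oo] --> 0.
  by apply: cvg_expr; rewrite ger0_norm.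
have q_cvg : q n @[n --> \oo] --> p.
  apply: (@squeeze_cvgr _ _ _ _ (fun n => p - 2 * rho ^+ n) (fun=> p)).
  - by apply: nearW => n; exact: bounds.
  - rewrite -[X in _ --> X]subr0 -[X in _ - X](mulr0 2).
    by apply: cvgB; [exact: cvg_cst | apply: cvgMr].
  - exact: cvg_cst.
have [X qS] := freq_winS C k0 R.
have q_cvg' : q n.+1 @[n --> \oo] --> (score C k0)%:R / N ^+ 2 + rho ^+ 2 * p.
  rewrite /q; under eq_fun do rewrite qS.
  rewrite -[X in X / _]subr0 -(mulr0 X).
  apply: cvgD; last exact: cvgMr.
  by apply: cvgMl; apply: cvgB; [exact: cvg_cst | exact: cvgMr].
have fixpt : p = (score C k0)%:R / N ^+ 2 + rho ^+ 2 * p.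
  apply: (cvg_unique _ _ q_cvg') => //.
  by rewrite -(cvg_shiftS q) in q_cvg.
have m_lt : m < N by rewrite -[N]mul1r -ltr_pdivrMr.
have den : N ^+ 2 - m ^+ 2 != 0.
  rewrite subr_sqr mulf_neq0 // gt_eqF ?subr_gt0 //.
  by rewrite ltr_wpDr.
apply: (mulIf den); rewrite divfK // mulrBr {1}fixpt /rho; field.
exact: lt0r_neq0.
Qed.

End FairStacks.

(** * Existence of recursive strategies *)

Section Existence.
Variables (h : nat) (C : {set h.-tuple bool}) (k0 : h_strategy h).

Definition recursive_fun (v : stack_space) : nat :=
  if pselect (exists m, block h v m \in C) is left hitC then
    ex_minn hitC * h + k0 (block h v (ex_minn hitC))
  else 0.

Lemma recursive_funP : recursive_with C k0 recursive_fun.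
Proof.
move=> v m before_m at_m; rewrite /recursive_fun.
case: pselect => [hitC|[]]; last by exists m.
case: ex_minnP => i iC min_i; suff -> : i = m by [].
apply/eqP; rewrite eqn_leq min_i // leqNgt.
by apply/negP => /before_m; rewrite iC.
Qed.

Lemma measurable_block (m : nat) (G : set (h.-tuple bool)) :
  measurable [set v : stack_space | G (block h v m)].
Proof.
have -> : [set v : stack_space | G (block h v m)] =
    \bigcup_(t in G) \bigcap_(i in [set: 'I_h])
      [set v | v (m * h + i)%N = tnth t i].
  apply/seteqP; split => v /=.
    by move=> Gv; exists (block h v m) => //= i _; rewrite tnth_mktuple.
  move=> [t Gt vt]; suff -> : block h v m = t by [].
  by apply: eq_from_tnth => i; rewrite tnth_mktuple; exact: vt.
apply: fin_bigcup_measurable => // t _; apply: fin_bigcap_measurable => // i _.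
by apply: sub_sigma_algebra; exists (m * h + i)%N, (tnth t i).
Qed.

(** The preimage of [Y] is cut according to the first block in [C], if any; each
    piece is a countable intersection of conditions on single blocks. *)
Lemma measurable_recursive_fun : measurable_fun setT recursive_fun.
Proof.
move=> _ Y _; rewrite setTI.
pose skipped m : set stack_space := [set v | block h v m \notin C].
have mskipped m : measurable (skipped m).
  exact: (measurable_block m [set t | t \notin C]).
have -> : recursive_fun @^-1` Y =
    \bigcup_m (\bigcap_(j in `I_m) skipped j `&`
       [set v | block h v m \in C /\ Y (m * h + k0 (block h v m))%N]) `|`
    (\bigcap_m skipped m `&` [set v | Y 0%N]).
  apply/seteqP; split => v /=.
    rewrite /recursive_fun; case: pselect => [hitC|noC] Yv; [left|right].
      move: Yv; case: ex_minnP => i iC min_i Yv.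
      exists i => //; split => //= j ji.
      by apply/negP => /min_i; rewrite leqNgt ji.
    by split=> // m _; apply/negP => mC; apply: noC; exists m.
  case=> [[m _ [before_m [at_m Ym]]] | [noC Y0]].
    by rewrite (recursive_funP before_m at_m).
  rewrite /recursive_fun; case: pselect => // -[m mC].
  by have := noC m Logic.I; rewrite /skipped /= mC.
apply: measurableU.
  apply: bigcupT_measurable => m; apply: measurableI.
    by apply: fin_bigcap_measurable => // j _; exact: mskipped.
  exact: (measurable_block m [set t | t \in C /\ Y (m * h + k0 t)%N]).
apply: measurableI; first exact: bigcapT_measurable.
have [Y0|nY0] := pselect (Y 0%N).
  by rewrite (_ : [set v | _] = setT) //; apply/seteqP; split.
by rewrite (_ : [set v | _] = set0) //; apply/seteqP; split.
Qed.

HB.instance Definition _ :=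
  isMeasurableFun.Build _ _ stack_space nat
    recursive_fun measurable_recursive_fun.

Definition recursive_strategy : strategy := recursive_fun.
End Existence.

(** * A strategy of order 5 *)

(** An explicit list of the blocks, which, unlike the enumeration of a finite
    type, can be evaluated. *)
Fixpoint words (h : nat) : seq bitseq :=
  if h is h'.+1 then map (cons true) (words h') ++ map (cons false) (words h')
  else [:: [::]].

Lemma mem_words h s : (s \in words h) = (size s == h).
Proof.
elim: h s => [|h IH] [|b s]; rewrite ?inE //= mem_cat.
  by apply/orP => -[] /mapP[].
by apply/orP/idP => [[] /mapP[s' s'h [_ ->]]|sh];
  rewrite ?eqSS -?IH //; case: b; [left|right]; rewrite map_f // IH.
Qed.

Lemma words_uniq h : uniq (words h).
Proof.
elim: h => //= h IH.
rewrite cat_uniq !map_inj_uniq ?IH ?andbT => [|? ? []|? ? []] //.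
by apply/hasPn => _ /mapP[s _ ->]; apply/mapP => -[].
Qed.

Lemma sum_words h (G : bitseq -> nat) :
  (\sum_(t : h.-tuple bool) G t = \sum_(s <- words h) G s)%N.
Proof.
rewrite -big_enum -(big_map (@tval _ _) xpredT G); apply: perm_big.
apply: uniq_perm; first by rewrite map_inj_uniq ?enum_uniq //; exact: val_inj.
  exact: words_uniq.
move=> s; rewrite mem_words; apply/mapP/idP => [[t _ ->]|sh].
  by rewrite size_tuple.
by exists (Tuple sh); rewrite // mem_enum.
Qed.

Definition mixed (s : bitseq) : bool := (true \in s) && (false \in s).

(** One of many functions of score 357, obtained by computer search. *)
Definition named_position (s : bitseq) : nat :=
  match s with
  | [:: _; _; _; true; false] => 4
  | [:: _; _; true; _; false] => 2
  | [:: true; _; _; _; false] => 1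
  | [:: _; _; _; _; false] => 0
  | [:: _; _; true; false; true] => 2
  | [:: false; true; true; true; true] => 0
  | _ => 3
  end.

Definition mixed_words : {set 5.-tuple bool} :=
  [set t : 5.-tuple bool | mixed t]%SET.
Definition k_mixed : h_strategy 5 := fun t => inord (named_position t).

Lemma card_skipped : #|~: mixed_words|%SET = 2%N.
Proof.
have -> : #|~: mixed_words| = (\sum_(t : 5.-tuple bool) ~~ mixed t)%N.
  rewrite -sum1_card big_mkcond; apply: eq_bigr => t _.
  by rewrite !inE; case: mixed.
by rewrite (sum_words 5 (fun s => nat_of_bool (~~ mixed s))) unlock; vm_compute.
Qed.

Lemma score_k_mixed : score mixed_words k_mixed = 357%N.
Proof.
pose gain (u v : bitseq) : nat :=
  mixed u && nth false v (named_position u) &&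
  (mixed v ==> nth false u (named_position v)).
have named_lt (u : bitseq) : (named_position u < 5)%N.
  by case: u => [|[][|[][|[][|[][|[][]]]]]].
transitivity (\sum_(u : 5.-tuple bool) \sum_(v : 5.-tuple bool) gain u v)%N.
  rewrite /score big_mkcond; apply: eq_bigr => u _; rewrite inE /gain.
  case: (mixed u) => /=; last by rewrite big1.
  apply: eq_bigr => v _; rewrite inE !(tnth_nth false) !inordK //.
under eq_bigr do rewrite (sum_words 5 (gain _)).
rewrite (sum_words 5 (fun u => (\sum_(v <- words 5) gain u v)%N)) unlock.
by vm_compute.
Qed.

Theorem theorem14 :
  exists K : strategy,
    recursive 5 K /\
    forall (R : realType) (d : measure_display) (T : measurableType d)
      (P : probability T R) (U V : nat -> {RV P >-> bool}),
      fair_independent_stacks U V ->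
      P (victory U V K K) = (7 / 20)%:E.
Proof.
have mixed0 : mixed_words != finset.set0.
  by apply/set0Pn; exists [tuple true; false; true; true; true]; rewrite inE.
exists (recursive_strategy mixed_words k_mixed); split.
  exists mixed_words, k_mixed; split => //; last exact: recursive_funP.
  apply/properP; split; first by apply/fintype.subsetP => t; rewrite inE.
  by exists [tuple true; true; true; true; true]; rewrite inE.
move=> R d T P U V fairUV.
rewrite (recursive_victory fairUV mixed0 (@recursive_funP _ _ _)).
rewrite score_k_mixed card_skipped card_tuple card_bool; congr EFin.
by field.
Qed.
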